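(* Let $p$ be an odd prime, $\lambda\in\mathbb{C}_p$ with $|\lambda|_p<p^{-\frac{1}{p-1}}$, and $x_1,x_2\in\mathbb{Z}_p$. Let $i,n$ be integers with $1\le i\le n$ such that $(1+x_1-x_2-i\lambda)_{n-i,\lambda}\neq0$. Then $$(x_1)_{i,\lambda}=\frac{1}{(1+x_1-x_2-i\lambda)_{n-i,\lambda}}\sum_{k=i}^{n}\frac{\binom{k}{i}}{\binom{n}{i}}B_{k,n}(x_1,x_2|\lambda).$$
   Context: $\mathbb{C}_p$ is the completion of the algebraic closure of $\mathbb{Q}_p$, with $|p|_p=1/p$. For $x\in\mathbb{C}_p$ define $(x)_{0,\lambda}=1$ and $(x)_{n,\lambda}=x(x-\lambda)\cdots(x-(n-1)\lambda)$ for $n\ge1$. The two-variable degenerate Bernstein polynomials are $B_{k,n}(x_1,x_2|\lambda)=\binom{n}{k}(x_1)_{k,\lambda}(1-x_2)_{n-k,\lambda}$ for integers $0\le k\le n$. *)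

(* Defs.v *)
From HB Require Import structures.
From mathcomp Require Import all_boot all_order all_algebra.
From mathcomp Require Import reals exp.
Set Implicit Arguments.
Unset Strict Implicit.
Unset Printing Implicit Defensive.
Import Order.TTheory GRing.Theory Num.Theory.
Local Open Scope ring_scope.

(* MathComp has no p-adic fields.  C_p is specified by its definition as the
   tower  rat -> Q_p -> algebraic closure of Q_p -> C_p : a completion, an
   algebraic closure carrying an extension of the absolute value, and again a
   completion.  Absolute values are plain functions into the reals, because
   the norms of MathComp satisfy |x *+ n| = |x| *+ n, which excludes
   ultrametric ones. *)

Definition nonarch_abs (R : realType) (K : fieldType) (v : K -> R) : Prop :=
  [/\ forall x, 0 <= v x,
      forall x, (v x == 0) = (x == 0),
      forall x y, v (x * y) = v x * v y
    & forall x y, v (x + y) <= Num.max (v x) (v y)].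

Definition abs_cauchy (R : realType) (K : fieldType) (v : K -> R)
    (u : nat -> K) : Prop :=
  forall e : R, 0 < e ->
    exists N : nat, forall m n : nat, (N <= m)%N -> (N <= n)%N ->
      v (u m - u n) < e.

Definition abs_cvg (R : realType) (K : fieldType) (v : K -> R)
    (u : nat -> K) (l : K) : Prop :=
  forall e : R, 0 < e ->
    exists N : nat, forall n : nat, (N <= n)%N -> v (u n - l) < e.

Definition abs_complete (R : realType) (K : fieldType) (v : K -> R) : Prop :=
  forall u : nat -> K, abs_cauchy v u -> exists l : K, abs_cvg v u l.

Definition is_completion (R : realType) (K L : fieldType)
    (v : K -> R) (w : L -> R) (f : {rmorphism K -> L}) : Prop :=
  [/\ nonarch_abs w,
      forall x : K, w (f x) = v x,
      forall (y : L) (e : R), 0 < e -> exists x : K, w (y - f x) < e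
    & abs_complete w].

Definition is_algebraic_closure (K L : fieldType) (f : {rmorphism K -> L}) :
    Prop :=
  GRing.closed_field_axiom L /\ (forall y : L, algebraicOver f y).

(* numq x and denq x are coprime, so the exponent is minus the p-adic
   valuation of x, whence |p| = 1/p. *)
Definition padic_abs (R : realType) (p : nat) (x : rat) : R :=
  if x == 0 then 0
  else p%:R ^ ((logn p `|denq x|)%:Z - (logn p `|numq x|)%:Z).

Lemma padic_abs_p (R : realType) (p : nat) :
  prime p -> padic_abs R p p%:R = p%:R^-1.
Proof.
move=> pP; rewrite /padic_abs pnatr_eq0 eqn0Ngt prime_gt0 //=.
rewrite -[p%:R : rat]/((p%:Z)%:~R) numq_int denq_int.
by rewrite !absz_nat logn1 lognE pP prime_gt0 // dvdnn divnn prime_gt0 //= logn1.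
Qed.

Record padicComplex (R : realType) (p : nat) := PadicComplex {
  Qp : fieldType;
  Qpbar : fieldType;
  Cp :> fieldType;
  Qp_abs : Qp -> R;
  Qpbar_abs : Qpbar -> R;
  Cp_abs : Cp -> R;
  rat_to_Qp : {rmorphism rat -> Qp};
  Qp_to_Qpbar : {rmorphism Qp -> Qpbar};
  Qpbar_to_Cp : {rmorphism Qpbar -> Cp};
  Qp_completion : is_completion (padic_abs R p) Qp_abs rat_to_Qp;
  Qpbar_closure : is_algebraic_closure Qp_to_Qpbar;
  Qpbar_abs_nonarch : nonarch_abs Qpbar_abs;
  Qpbar_abs_extends : forall x : Qp, Qpbar_abs (Qp_to_Qpbar x) = Qp_abs x;
  Cp_completion : is_completion Qpbar_abs Cp_abs Qpbar_to_Cp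
}.

(* Z_p, as a subset of C_p: the image of the closed unit ball of Q_p. *)
Definition in_Zp (R : realType) (p : nat) (C : padicComplex R p) (x : C) :
    Prop :=
  exists2 y : Qp C, Qp_abs y <= 1 & x = Qpbar_to_Cp C (Qp_to_Qpbar C y).

Definition dfact (K : fieldType) (lam x : K) (n : nat) : K :=
  \prod_(j < n) (x - j%:R * lam).

Definition dBernstein (K : fieldType) (lam : K) (k n : nat) (x1 x2 : K) : K :=
  'C(n, k)%:R * dfact lam x1 k * dfact lam (1 - x2) (n - k).

(* Main.v *)
Require Import Defs.
From mathcomp Require Import all_boot all_order all_algebra.
From mathcomp Require Import reals exp.
From mathcomp Require Import ring.
Import Order.TTheory GRing.Theory Num.Theory.
Local Open Scope ring_scope.

(** The coefficient identity [C(k,i) C(n,k) = C(n,i) C(n-i,k-i)] and the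
    splitting [(x)_k = (x)_i (x - i lam)_(k-i)] turn the sum into [(x1)_i] times
    a Chu-Vandermonde convolution of degenerate falling factorials, which
    evaluates to [(1 + x1 - x2 - i lam)_(n-i)].  Of [C_p] only the field
    structure and characteristic zero matter. *)

Lemma dfactS (K : fieldType) (lam x : K) (n : nat) :
  dfact lam x n.+1 = dfact lam x n * (x - n%:R * lam).
Proof. by rewrite /dfact big_ord_recr. Qed.

Lemma dfact_addn (K : fieldType) (lam x : K) (m n : nat) :
  dfact lam x (m + n) = dfact lam x m * dfact lam (x - m%:R * lam) n.
Proof.
elim: n => [|n IHn]; first by rewrite addn0 {3}/dfact big_ord0 mulr1.
by rewrite addnS !dfactS IHn -mulrA natrD mulrDl opprD addrA.
Qed.

(** Chu-Vandermonde for step [lam], by induction on [n] with Pascal's rule. *)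
Lemma dfactD (K : fieldType) (lam x y : K) (n : nat) :
  dfact lam (x + y) n =
    \sum_(j < n.+1) 'C(n, j)%:R * dfact lam x j * dfact lam y (n - j).
Proof.
elim: n => [|n IHn]; first by rewrite big_ord1 /dfact !big_ord0 !mulr1.
(* Index shift: an extra term [j = n.+1] costs nothing since ['C(n, n.+1)] is 0, and then the term
   [j = 0] is peeled off. *)
have split_last : \sum_(j < n.+1)
      'C(n, j)%:R * dfact lam x j * dfact lam y (n.+1 - j) =
    dfact lam x 0 * dfact lam y n.+1 + \sum_(j < n.+1)
      'C(n, j.+1)%:R * dfact lam x j.+1 * dfact lam y (n - j).
  transitivity (\sum_(j < n.+2)
      'C(n, j)%:R * dfact lam x j * dfact lam y (n.+1 - j)).
    by rewrite [RHS]big_ord_recr /= bin_small // !mul0r addr0.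
  by rewrite big_ord_recl bin0 mul1r subn0.
rewrite big_ord_recl bin0 subn0 mul1r.
under eq_bigr => j _ do rewrite lift0 binS natrD subSS !mulrDl.
rewrite big_split addrA -split_last -big_split dfactS IHn mulr_suml.
(* Termwise, with [n] written as [j + (n - j)], the new factor [x + y - n lam] is
   [(x - j lam) + (y - (n - j) lam)]. *)
apply: eq_bigr => -[j /=]; rewrite ltnS => le_jn _.
rewrite subSn // !dfactS -{3}(subnKC le_jn) natrD.
ring.
Qed.

(** For [j <= m], both sides times [i! j! (m - j)!] give [(m + i)!]; otherwise both vanish. The
    shifts by [i] avoid truncated subtraction. *)
Lemma mul_bin_trans (i j m : nat) :
  ('C(j + i, i) * 'C(m + i, j + i) = 'C(m + i, i) * 'C(m, j))%N.
Proof.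
have [lt_mj|le_jm] := ltnP m j.
  by rewrite (bin_small lt_mj) (@bin_small (m + i)) ?ltn_add2r // !muln0.
apply/eqP; rewrite -(eqn_pmul2r (fact_gt0 i)) -(eqn_pmul2r (fact_gt0 j)).
rewrite -(eqn_pmul2r (fact_gt0 (m - j))); apply/eqP.
have eq_ji := bin_fact (leq_addl j i); rewrite addnK in eq_ji.
have eq_mi := bin_fact (leq_addl m i); rewrite addnK in eq_mi.
have eq_mji : (j + i <= m + i)%N by rewrite leq_add2r.
have {eq_mji} := bin_fact eq_mji; rewrite subnDr => eq_mji.
have eq_mj := bin_fact le_jm.
transitivity ((m + i)`!)%N; first by rewrite -eq_mji -eq_ji; ring.
by rewrite -eq_mi -eq_mj; ring.
Qed.

Lemma sum_bin_dBernstein (K : fieldType) (lam x1 x2 : K) (i n : nat) :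
    (i <= n)%N -> 'C(n, i)%:R != 0 :> K ->
  \sum_(i <= k < n.+1) ('C(k, i)%:R / 'C(n, i)%:R) * dBernstein lam k n x1 x2 =
  dfact lam x1 i * dfact lam (1 + x1 - x2 - i%:R * lam) (n - i).
Proof.
move=> le_in; move: (n - i)%N (subnK le_in) => m <- {n le_in} nz_bin.
rewrite -{1}[i]add0n big_addn -addSn addnK big_mkord.
have -> : 1 + x1 - x2 - i%:R * lam = (x1 - i%:R * lam) + (1 - x2) by ring.
rewrite dfactD mulr_sumr; apply: eq_bigr => j _.
rewrite /dBernstein subnDr [in dfact lam x1 (j + i)]addnC dfact_addn.
have : 'C(j + i, i)%:R * 'C(m + i, j + i)%:R =
       'C(m + i, i)%:R * 'C(m, j)%:R :> K by rewrite -!natrM mul_bin_trans.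
(* Solved for ['C(m, j)], so that [ring] can treat the inverse of ['C(m + i, i)] as an atom. *)
move/(canLR (mulKf nz_bin)) => bin_trans.
rewrite -bin_trans.
ring.
Qed.

(** Characteristic zero passes from [rat] up the tower, as field morphisms are injective. *)
Lemma padicComplex_natr_eq0 (R : realType) (p : nat) (C : padicComplex R p)
  (n : nat) : (n%:R == 0 :> C) = (n == 0)%N.
Proof.
rewrite -(rmorph_nat (Qpbar_to_Cp C)) fmorph_eq0.
rewrite -(rmorph_nat (Qp_to_Qpbar C)) fmorph_eq0.
by rewrite -(rmorph_nat (rat_to_Qp C)) fmorph_eq0 pnatr_eq0.
Qed.

Theorem theorem2p8 (R : realType) (p : nat) (p_prime : prime p)
    (p_odd : odd p) (C : padicComplex R p) (lam x1 x2 : C)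
    (lam_small : Cp_abs lam < (p%:R : R) `^ (- (p%:R - 1)^-1))
    (x1_Zp : in_Zp x1) (x2_Zp : in_Zp x2)
    (i n : nat) (i_ge1 : (1 <= i)%N) (i_le_n : (i <= n)%N)
    (den_neq0 : dfact lam (1 + x1 - x2 - i%:R * lam) (n - i) != 0) :
  dfact lam x1 i =
    1 / dfact lam (1 + x1 - x2 - i%:R * lam) (n - i) *
    \sum_(i <= k < n.+1)
      ('C(k, i)%:R / 'C(n, i)%:R) * dBernstein lam k n x1 x2.
Proof.
rewrite sum_bin_dBernstein ?padicComplex_natr_eq0 -?lt0n ?bin_gt0 //.
by rewrite mul1r mulrC mulfK.
Qed.
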